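(* For each of the $14$ edge-transitive classes $T$, every countable group $C$ is isomorphic to a subgroup of $\mathrm{Aut}\,\mathcal{M}$ for some map $\mathcal{M}$ in $T$.
   Context: Let $\Gamma=\langle R_0,R_1,R_2\mid R_i^2=(R_0R_2)^2=1\rangle$ and $E=\langle R_0,R_2\rangle\cong V_4$. A (connected) map $\mathcal{M}$ (possibly non-orientable, non-compact, or with non-empty boundary) is identified, up to isomorphism, with a transitive permutation representation of $\Gamma$ on a set $\Phi$ of flags, or equivalently with a conjugacy class of subgroups $M\le\Gamma$ (its map subgroups, the stabilisers of flags). Its vertices, edges and faces are the orbits on $\Phi$ of $\langle R_1,R_2\rangle$, $\langle R_0,R_2\rangle$ and $\langle R_0,R_1\rangle$. Its automorphism group $\mathrm{Aut}\,\mathcal{M}$ is the centraliser of $\Gamma$ in $\mathrm{Sym}\,\Phi$; it is isomorphic to $N_\Gamma(M)/M$. The map is edge-transitive if $\mathrm{Aut}\,\mathcal{M}$ is transitive on edges, equivalently $\Gamma=N_\Gamma(M)E$. There are $14$ conjugacy classes of subgroups $N\le\Gamma$ with $\Gamma=NE$, represented by the following subgroups $N(T)$. $N(1)=\Gamma$. Those of index $2$ are determined by which generators $R_i$ they contain: $N(2)$ contains exactly $R_1,R_2$; $N(2^* )$ exactly $R_0,R_1$; $N(2^P)$ exactly $R_1$; $N(2\,\mathrm{ex})$ exactly $R_2$; $N(2^*\mathrm{ex})$ exactly $R_0$; $N(2^P\mathrm{ex})$ none of them. Those of index $4$ are point stabilisers (defined up to conjugacy) in the actions of $\Gamma$ on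 $\{1,2,3,4\}$ with $R_0\mapsto(12)(34)$, $R_2\mapsto(14)(23)$ and $R_1\mapsto$: identity for $T=3$; $(14)$ for $T=4$; $(12)$ for $T=4^*$; $(13)$ for $T=4^P$; $(14)(23)$ for $T=5$; $(12)(34)$ for $T=5^*$; $(13)(24)$ for $T=5^P$. An edge-transitive map $\mathcal{M}$ is in class $T$ if $N_\Gamma(M)$ is conjugate to $N(T)$. *)

(* Defs.v *)
From HB Require Import structures.
From mathcomp Require Import all_boot all_fingroup.
From mathcomp Require Import boolp classical_sets functions cardinality.

Set Implicit Arguments.
Unset Strict Implicit.
Unset Printing Implicit Defensive.

Local Open Scope classical_set_scope.
Local Open Scope group_scope.

Section Subgroups.
Context (G : groupType).
Implicit Types (A H N : set G) (g : G).

Definition is_subgroup H : Prop :=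
  [/\ H 1, forall g h, H g -> H h -> H (g * h) & forall g, H g -> H g^-1].

Definition generated_subgroup A : set G := smallest is_subgroup A.

Definition conj_set A g : set G := [set a ^ g | a in A].

Definition conjugate_sets A B : Prop := exists g, conj_set A g = B.

Definition normaliser A : set G := [set g | conj_set A g = A].

(* [t] is a transversal of the [n] left cosets of [N]. *)
Definition has_index N (n : nat) : Prop :=
  exists t : 'I_n -> G, forall g, exists! i, N ((t i)^-1 * g).

Definition centraliser A : set G := [set g | forall a, A a -> g * a = a * g].

End Subgroups.

Definition isomorphic_to_subgroup (C G : groupType) (A : set G) : Prop :=
  exists H : set G, [/\ is_subgroup H, H `<=` A
    & exists f : {multiplicative C -> G}, set_bij [set: C] H f].

Lemma multiplicative1 (G H : groupType) (f : {multiplicative G -> H}) : f 1 = 1.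
Proof. by apply: (mulgI (f 1)); rewrite -gmulfM !mulg1. Qed.

(* Permutations act on the right, as those of [perm]: [(s * t) x = t (s x)]. *)
Record SymGroup (T : Type) := MkSymGroup {
  sym_fun :> T -> T;
  sym_inv : T -> T;
  sym_funK : cancel sym_fun sym_inv;
  sym_invK : cancel sym_inv sym_fun }.

Section SymGroupTheory.
Context (T : Type).
Implicit Types s t u : SymGroup T.

Lemma symP s t : s =1 t -> s = t.
Proof.
case: s t => [f f' fK f'K] [g g' gK g'K] /= /funext fg; subst g.
have e : f' = g' by apply: funext => x; rewrite -{1}(g'K x) fK.
subst g'; congr MkSymGroup; exact: Prop_irrelevance.
Qed.

HB.instance Definition _ := gen_eqMixin (SymGroup T).
HB.instance Definition _ := gen_choiceMixin (SymGroup T).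

Definition sym_one : SymGroup T := @MkSymGroup T id id (fun=> erefl) (fun=> erefl).

Definition sym_mul s t : SymGroup T :=
  MkSymGroup (can_comp (sym_funK t) (sym_funK s))
        (can_comp (sym_invK s) (sym_invK t)).

Definition sym_opp s : SymGroup T := MkSymGroup (sym_invK s) (sym_funK s).

Fact sym_mulA : associative sym_mul.
Proof. by move=> s t u; apply: symP. Qed.
Fact sym_mul1 : left_id sym_one sym_mul.
Proof. by move=> s; apply: symP. Qed.
Fact sym_1mul : right_id sym_one sym_mul.
Proof. by move=> s; apply: symP. Qed.
Fact sym_mulV : left_inverse sym_one sym_opp sym_mul.
Proof. by move=> s; apply: symP => x /=; rewrite sym_invK. Qed.
Fact sym_Vmul : right_inverse sym_one sym_opp sym_mul.
Proof. by move=> s; apply: symP => x /=; rewrite sym_funK. Qed.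

HB.instance Definition _ :=
  isGroup.Build (SymGroup T) sym_mulA sym_mul1 sym_1mul sym_mulV sym_Vmul.

End SymGroupTheory.

Definition i0 : 'I_3 := @Ordinal 3 0 isT.
Definition i1 : 'I_3 := @Ordinal 3 1 isT.
Definition i2 : 'I_3 := @Ordinal 3 2 isT.

(* Gamma = < R0, R1, R2 | Ri^2 = (R0 R2)^2 = 1 > is built as words modulo the
   congruence generated by the relations; formal inverses of the generators
   are not needed, since [Ri^2 = 1]. *)
Inductive Gamma_cong : seq 'I_3 -> seq 'I_3 -> Prop :=
| Gamma_sq i : Gamma_cong [:: i; i] [::]
| Gamma_comm : Gamma_cong [:: i0; i2; i0; i2] [::]
| Gamma_refl w : Gamma_cong w w
| Gamma_sym w w' : Gamma_cong w w' -> Gamma_cong w' w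
| Gamma_trans w1 w2 w3 :
    Gamma_cong w1 w2 -> Gamma_cong w2 w3 -> Gamma_cong w1 w3
| Gamma_cat u u' v v' :
    Gamma_cong u u' -> Gamma_cong v v' -> Gamma_cong (u ++ v) (u' ++ v').

Definition Gamma_rel : rel (seq 'I_3) := fun w w' => `[< Gamma_cong w w' >].

Fact Gamma_rel_refl : reflexive Gamma_rel.
Proof. by move=> w; apply/asboolP; exact: Gamma_refl. Qed.
Fact Gamma_rel_sym : symmetric Gamma_rel.
Proof. by move=> w w'; apply/asboolP/asboolP; exact: Gamma_sym. Qed.
Fact Gamma_rel_trans : transitive Gamma_rel.
Proof.
move=> w2 w1 w3 /asboolP h /asboolP h'; apply/asboolP.
exact: Gamma_trans h h'.
Qed.

Canonical Gamma_equiv :=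
  EquivRel Gamma_rel Gamma_rel_refl Gamma_rel_sym Gamma_rel_trans.

Definition Gamma : Type := {eq_quot Gamma_equiv}%qT.
HB.instance Definition _ := Choice.on Gamma.

Definition word (w : seq 'I_3) : Gamma := (\pi_({eq_quot Gamma_equiv}%qT) w)%qT.
Definition word_of (g : Gamma) : seq 'I_3 := generic_quotient.repr g.

Lemma word_ofK : cancel word_of word.
Proof. by move=> g; rewrite /word /word_of reprK. Qed.

Lemma wordP w w' : word w = word w' <-> Gamma_cong w w'.
Proof.
split=> [/eqmodP/asboolP//|h]; by apply/eqmodP/asboolP.
Qed.

Lemma word_of_word w : Gamma_cong (word_of (word w)) w.
Proof. by apply/wordP; rewrite word_ofK. Qed.

Definition Gamma_mul (g h : Gamma) : Gamma := word (word_of g ++ word_of h).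
Definition Gamma_inv (g : Gamma) : Gamma := word (rev (word_of g)).

Lemma Gamma_mulE u v : Gamma_mul (word u) (word v) = word (u ++ v).
Proof. by apply/wordP; apply: Gamma_cat; exact: word_of_word. Qed.

Lemma Gamma_cong_rev w : Gamma_cong (rev w ++ w) [::].
Proof.
elim: w => [|i w IH]; first exact: Gamma_refl.
rewrite rev_cons cat_rcons -[rev w ++ _]/(rev w ++ ([:: i; i] ++ w)).
apply: Gamma_trans IH; apply: Gamma_cat; first exact: Gamma_refl.
exact: (Gamma_cat (Gamma_sq i) (Gamma_refl w)).
Qed.

Fact Gamma_mulA : associative Gamma_mul.
Proof.
move=> g h k; rewrite -(word_ofK g) -(word_ofK h) -(word_ofK k).
by rewrite !Gamma_mulE catA.
Qed.
Fact Gamma_mul1 : left_id (word [::]) Gamma_mul.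
Proof. by move=> g; rewrite -(word_ofK g) Gamma_mulE. Qed.
Fact Gamma_1mul : right_id (word [::]) Gamma_mul.
Proof. by move=> g; rewrite -(word_ofK g) Gamma_mulE cats0. Qed.
Fact Gamma_mulV : left_inverse (word [::]) Gamma_inv Gamma_mul.
Proof.
move=> g; rewrite -{2}(word_ofK g) /Gamma_inv Gamma_mulE.
by apply/wordP; exact: Gamma_cong_rev.
Qed.
Fact Gamma_Vmul : right_inverse (word [::]) Gamma_inv Gamma_mul.
Proof.
move=> g; rewrite -{1}(word_ofK g) /Gamma_inv Gamma_mulE.
by apply/wordP; rewrite -{1}(revK (word_of g)); exact: Gamma_cong_rev.
Qed.

HB.instance Definition _ :=
  isGroup.Build Gamma Gamma_mulA Gamma_mul1 Gamma_1mul Gamma_mulV Gamma_Vmul.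

Definition R (i : 'I_3) : Gamma := word [:: i].

Lemma word_cat u v : word (u ++ v) = word u * word v.
Proof. by rewrite -Gamma_mulE. Qed.

Lemma R_sq i : R i * R i = 1.
Proof. by rewrite -word_cat; apply/wordP; exact: Gamma_sq. Qed.

Lemma R_comm : (R i0 * R i2) * (R i0 * R i2) = 1.
Proof.
rewrite /R -!(word_cat [:: _] [:: _]) -(word_cat [:: _; _]).
by apply/wordP; exact: Gamma_comm.
Qed.

Section Universal.
Context (G : groupType) (r : 'I_3 -> G).
Hypothesis r_sq : forall i, r i * r i = 1.
Hypothesis r_comm : (r i0 * r i2) * (r i0 * r i2) = 1.

Let ev (w : seq 'I_3) : G := foldr (fun i x => r i * x) 1 w.

Let ev_cat u v : ev (u ++ v) = ev u * ev v.
Proof. by elim: u => [|i u IH] /=; rewrite ?mul1g// IH mulgA. Qed.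

Let ev_cong u v : Gamma_cong u v -> ev u = ev v.
Proof.
elim=> //= [i||w1 w2 w3 _ -> _ ->//|u1 u2 v1 v2 _ e _ e'].
- by rewrite mulg1 r_sq.
- by rewrite mulg1 -r_comm !mulgA.
- by rewrite !ev_cat e e'.
Qed.

Let lift_fun (g : Gamma) : G := ev (word_of g).

Let lift_mul : {morph lift_fun : g h / g * h}.
Proof.
move=> g h; rewrite /lift_fun -ev_cat; apply: ev_cong.
exact: word_of_word.
Qed.

Lemma Gamma_universal :
  exists phi : {multiplicative Gamma -> G},
    (forall i, phi (R i) = r i) /\
    (forall psi : {multiplicative Gamma -> G},
       (forall i, psi (R i) = r i) -> psi =1 phi).
Proof.
pose M := isMultiplicative.Build Gamma G lift_fun lift_mul.
pose phi : {multiplicative Gamma -> G} := HB.pack lift_fun M.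
have liftR i : phi (R i) = r i.
  by rewrite /= /lift_fun (ev_cong (word_of_word _)) /= mulg1.
exists phi; split => // psi psiR g; rewrite -(word_ofK g).
elim: (word_of g) => [|i w IH]; first by rewrite -[word [::]]/(1 : Gamma) !multiplicative1.
by rewrite -cat1s word_cat !gmulfM -/(R i) psiR liftR IH.
Qed.

End Universal.

Record flagmap := FlagMap {
  flag : Type;
  flag_inh : inhabited flag;
  rep : {multiplicative Gamma -> SymGroup flag};
  rep_trans : forall x y : flag, exists g, rep g x = y }.

Definition map_subgroup (M : flagmap) (x : flag M) : set Gamma :=
  [set g | rep M g x = x].

Definition map_aut (M : flagmap) : set (SymGroup (flag M)) := centraliser (range (rep M)).
Arguments map_aut : clear implicits.

Definition E : set Gamma := generated_subgroup [set R i0; R i2].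

Definition edges (M : flagmap) : set (set (flag M)) :=
  range (fun x => [set rep M g x | g in E]).
Arguments edges : clear implicits.

Definition edge_transitive (M : flagmap) : Prop :=
  forall e e', edges M e -> edges M e' -> exists2 a, map_aut M a & a @` e = e'.

Inductive et_class : Set :=
| T1
| T2 | T2star | T2P | T2ex | T2starex | T2Pex
| T3
| T4 | T4star | T4P
| T5 | T5star | T5P.

Definition index2_containing (s : seq 'I_3) (N : set Gamma) : Prop :=
  [/\ is_subgroup N, has_index N 2 & forall i, N (R i) <-> i \in s].

Definition p1 : 'I_4 := @Ordinal 4 0 isT.
Definition p2 : 'I_4 := @Ordinal 4 1 isT.
Definition p3 : 'I_4 := @Ordinal 4 2 isT.
Definition p4 : 'I_4 := @Ordinal 4 3 isT.

Definition point_stabiliser (r1 : 'S_4) (N : set Gamma) : Prop :=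
  exists phi : {multiplicative Gamma -> 'S_4},
    [/\ phi (R i0) = tperm p1 p2 * tperm p3 p4,
        phi (R i1) = r1,
        phi (R i2) = tperm p1 p4 * tperm p2 p3
      & exists p : 'I_4, N = [set g | phi g p = p]].

(* [N] is a subgroup N(T), which for classes 3 to 5 is only defined up to
   conjugacy. *)
Definition is_N (T : et_class) : set Gamma -> Prop :=
  match T with
  | T1 => fun N => N = [set: Gamma]
  | T2 => index2_containing [:: i1; i2]
  | T2star => index2_containing [:: i0; i1]
  | T2P => index2_containing [:: i1]
  | T2ex => index2_containing [:: i2]
  | T2starex => index2_containing [:: i0]
  | T2Pex => index2_containing [::]
  | T3 => point_stabiliser 1
  | T4 => point_stabiliser (tperm p1 p4)
  | T4star => point_stabiliser (tperm p1 p2)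
  | T4P => point_stabiliser (tperm p1 p3)
  | T5 => point_stabiliser (tperm p1 p4 * tperm p2 p3)
  | T5star => point_stabiliser (tperm p1 p2 * tperm p3 p4)
  | T5P => point_stabiliser (tperm p1 p3 * tperm p2 p4)
  end.

Definition in_class (M : flagmap) (T : et_class) : Prop :=
  edge_transitive M /\
  forall x : flag M, exists2 N, is_N T N &
    conjugate_sets N (normaliser (map_subgroup x)).

(* Main.v *)
Require Import Defs.
From HB Require Import structures.
From mathcomp Require Import all_boot all_fingroup ssralg ssrnum ssrint intdiv zmodp.
From mathcomp Require Import boolp classical_sets functions cardinality.
From mathcomp Require Import zify.
(* Imported again because finite group theory has its own normaliser. *)
Import Defs.

(** Write z for R1 and let (x, y) be two of the three involutions R0, R2,
R0 R2, chosen according to the class.  A map with map subgroup M lies in class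
T as soon as the normaliser of M is N(T), and its automorphism group then
contains every group that embeds in N(T) / M.  So M has to be normal in N(T),
have no further normalising element, and leave room for C in the quotient.
It is taken as the intersection K :&: L of two subgroups with separate jobs.

The normal subgroup K of Gamma gives room for C.  It is the kernel of an action
on a doubly infinite street with two sides: y crosses the street, y z walks along it,
and x acts at each site k by an involution H k of a fibre.  The translates
of x by powers of y z all act diagonally, so their commutators are easy to
read.  The nontrivial H k sit so that the commutator of two particular translates
is concentrated on one site on each side of the street.  A further commutator,
with exchanges indexed by C, vanishes on the second side and produces
a faithful copy of C on the first (lamplighter_embedding).
All the nontrivial sites are multiples of a prescribed m.  This has two
consequences.  The commutator of x with its translate by (y z)^n is in K
whenever m does not divide n.  And the words representing C collapse to 1 in
every quotient of Gamma where (y z)^m = 1, so they do not notice a finite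
action in which y z has order dividing m.

The subgroup L gives the asymmetry.  It is the pointwise stabiliser of one
fibre in a finite action of Gamma on P * S, fibred over an action on S
whose point stabiliser is N(T) and on which E is transitive; elements of N(T)
preserve the fibre and so normalise L.  If one word of K moves a point
of the fibre over the base point s0 and fixes the fibre over s
pointwise for every other s, then an element g carrying s0 to s cannot normalise
K :&: L: conjugating the word by the inverse of g puts it into K :&: L, and
conjugating back takes it out.  This is the lemma realisation.

Such finite actions are found with P = Z/7 and affine voltages.  Classes 2, 3
and 4, up to the choice of (x, y), use reflections and translations, and the
word detects whether z inverts a translation.  Classes 2ex and 5 need an
action not equivalent to its mirror image, and use the multiplication by 2,
whose inverse is the multiplication by 4.  In class 1 there is nothing to separate.
Permuting R0, R2 and R0 R2 turns the remaining classes into these. *)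

Set Implicit Arguments.
Unset Strict Implicit.
Unset Printing Implicit Defensive.

Local Open Scope classical_set_scope.
Local Open Scope group_scope.

(** * Homomorphisms of groups *)

Section Morphisms.
Context {G H : groupType} (f : {multiplicative G -> H}).

Lemma morph_mul g h : f (g * h) = f g * f h.
Proof. exact: gmulfM. Qed.

Lemma morph_inv g : f g^-1 = (f g)^-1.
Proof. by apply: (mulgI (f g)); rewrite -gmulfM !mulgV multiplicative1. Qed.

Lemma morph_conj g h : f (g ^ h) = f g ^ f h.
Proof. by rewrite /conjg !gmulfM morph_inv. Qed.

Lemma morph_comm g h : f [~ g, h] = [~ f g, f h].
Proof. by rewrite /commg gmulfM morph_inv morph_conj. Qed.

Lemma morph_exp g n : f (g ^+ n) = f g ^+ n.
Proof. by elim: n => [|n IH]; rewrite ?multiplicative1// !expgS gmulfM IH. Qed.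

End Morphisms.

(** * Normalisers of subsets *)

Section Normaliser.
Context {G : groupType}.
Implicit Types (M : set G) (g h : G).

Lemma conj_setP M g h : conj_set M g h <-> M (h ^ g^-1).
Proof.
split=> [[m Mm <-]|Mh]; first by rewrite conjgK.
by exists (h ^ g^-1); rewrite ?conjgKV.
Qed.

Lemma normaliserP M g : normaliser M g <-> forall h, M (h ^ g) <-> M h.
Proof.
split=> [nMg h|nMg].
  rewrite -{1}nMg; split=> [/conj_setP|Mh]; first by rewrite conjgK.
  by apply/conj_setP; rewrite conjgK.
apply/seteqP; split=> h; first by move=> [m /nMg + <-].
by move=> Mh; apply/conj_setP/nMg; rewrite conjgKV.
Qed.

Lemma normaliser_subgroup M : is_subgroup (normaliser M).
Proof.
split=> [|g h /normaliserP ng /normaliserP nh|g /normaliserP ng];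
  apply/normaliserP => k.
- by rewrite conjg1.
- by rewrite conjgM nh.
- by rewrite -ng conjgKV.
Qed.

Lemma normaliser_conj M g :
  normaliser (conj_set M g) = conj_set (normaliser M) g.
Proof.
apply/seteqP; split=> h.
  move=> /normaliserP nh; apply/conj_setP/normaliserP => k.
  have := nh (k ^ g); rewrite !conj_setP conjgK -!conjgM.
  by rewrite [h ^ _]conjgE invgK.
move=> /conj_setP/normaliserP nh; apply/normaliserP => k.
rewrite !conj_setP -(nh (k ^ g^-1)) -!conjgM.
by rewrite [h ^ _]conjgE invgK mulKg.
Qed.

End Normaliser.

(** * The map of right cosets of a subgroup *)

Section CosetMap.
Context (M : set Gamma) (M_subgroup : is_subgroup M).

Let M1 : M 1.
Proof. by case: M_subgroup. Qed.
Let MM g h : M g -> M h -> M (g * h).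
Proof. by case: M_subgroup => _ + _; apply. Qed.
Let MV g : M g -> M g^-1.
Proof. by case: M_subgroup => _ _; apply. Qed.

(** The right coset M g. *)
Definition rcoset_of (g : Gamma) : set Gamma := [set h | M (h * g^-1)].

Definition coset_flag : Type := {A : set Gamma | exists g, A = rcoset_of g}.

Definition flag_of (g : Gamma) : coset_flag :=
  exist _ (rcoset_of g) (ex_intro _ g erefl).

Lemma flag_eq (a b : coset_flag) : sval a = sval b -> a = b.
Proof. by case: a b => [A p] [B q] /= e; subst B; congr exist; exact: Prop_irrelevance. Qed.

Lemma flag_ofP (a : coset_flag) : exists g, a = flag_of g.
Proof. by case: a => A [g e]; exists g; apply: flag_eq. Qed.

Lemma flag_of_eq g h : flag_of g = flag_of h <-> M (g * h^-1).
Proof.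
split=> [/(congr1 sval)/= e|Mgh].
  have : rcoset_of g g by rewrite /rcoset_of/= mulgV; exact: M1.
  by rewrite e.
apply: flag_eq; apply/seteqP; split=> k /= Mk.
  by have := MM Mk Mgh; rewrite mulgA mulgVK.
by have := MM Mk (MV Mgh); rewrite invgM invgK mulgA mulgVK.
Qed.

Lemma right_mul_coset k (a : coset_flag) : exists g, [set h | sval a (h * k^-1)] = rcoset_of g.
Proof.
have [g ->] := flag_ofP a; exists (g * k).
by apply/funext => h; rewrite /= /rcoset_of/= invgM mulgA.
Qed.

Definition right_mul k (a : coset_flag) : coset_flag :=
  exist _ _ (right_mul_coset k a).

Lemma right_mulE k g : right_mul k (flag_of g) = flag_of (g * k).
Proof. by apply: flag_eq; apply/funext => h; rewrite /= /rcoset_of/= invgM mulgA. Qed.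

Lemma right_mulK k : cancel (right_mul k) (right_mul k^-1).
Proof. by move=> a; have [g ->] := flag_ofP a; rewrite !right_mulE mulgK. Qed.

Lemma right_mulVK k : cancel (right_mul k^-1) (right_mul k).
Proof. by move=> a; have [g ->] := flag_ofP a; rewrite !right_mulE mulgVK. Qed.

Definition right_sym k : SymGroup coset_flag :=
  MkSymGroup (right_mulK k) (right_mulVK k).

Lemma right_symM : {morph right_sym : k l / k * l}.
Proof.
by move=> k l; apply: symP => a; have [g ->] := flag_ofP a; rewrite /= !right_mulE mulgA.
Qed.

HB.instance Definition _ := isMultiplicative.Build _ _ right_sym right_symM.

Lemma right_sym_transitive (a b : coset_flag) : exists g, right_sym g a = b.
Proof.
have [g ->] := flag_ofP a; have [h ->] := flag_ofP b.
by exists (g^-1 * h); rewrite /= right_mulE mulVKg.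
Qed.

(** The map whose flags are the right cosets of M, with Gamma acting by right
translation: its map subgroups are exactly the conjugates of M. *)
Definition coset_map : flagmap :=
  @FlagMap coset_flag (inhabits (flag_of 1)) right_sym right_sym_transitive.

Lemma coset_map_subgroup g : @map_subgroup coset_map (flag_of g) = conj_set M g.
Proof.
apply/seteqP; split=> k; rewrite conj_setP /map_subgroup /= right_mulE.
  by move=> /flag_of_eq; rewrite conjgE invgK mulgA.
by move=> Mk; apply/flag_of_eq; rewrite conjgE invgK mulgA in Mk *.
Qed.

(** Left translation by n sends a right coset of M to a right coset exactly
because n normalises M.  The formula below is the preimage under the translation
by n, so that n acts by its inverse and the composition of permutations,
which is from left to right, follows the product in the normaliser. *)
Lemma left_mul_coset n (nMn : normaliser M n) (a : coset_flag) :
  exists g, [set h | sval a (n * h)] = rcoset_of g.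
Proof.
have [g ->] := flag_ofP a; exists (n^-1 * g); apply/funext => h; apply/propext.
rewrite /= /rcoset_of/= invgM invgK.
have /normaliserP nM := nMn; rewrite -nM.
by rewrite conjgE !mulgA mulVg mul1g.
Qed.

Definition left_mul n (nMn : normaliser M n) (a : coset_flag) : coset_flag :=
  exist _ _ (left_mul_coset nMn a).

Lemma left_mulE n (nMn : normaliser M n) g :
  left_mul nMn (flag_of g) = flag_of (n^-1 * g).
Proof.
apply: flag_eq; apply/funext => h; apply/propext.
rewrite /= /rcoset_of/= invgM invgK.
have /normaliserP nM := nMn; rewrite -nM.
by rewrite conjgE !mulgA mulVg mul1g.
Qed.

Lemma left_mulK n (nMn : normaliser M n) (nMV : normaliser M n^-1) :
  cancel (left_mul nMn) (left_mul nMV).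
Proof.
by move=> a; have [g ->] := flag_ofP a; rewrite !left_mulE invgK mulVKg.
Qed.

Lemma left_mulVK n (nMn : normaliser M n) (nMV : normaliser M n^-1) :
  cancel (left_mul nMV) (left_mul nMn).
Proof.
by move=> a; have [g ->] := flag_ofP a; rewrite !left_mulE invgK mulKg.
Qed.

Let nV n : normaliser M n -> normaliser M n^-1.
Proof. by case: (normaliser_subgroup M) => _ _; apply. Qed.

Definition left_sym n (nMn : normaliser M n) : SymGroup coset_flag :=
  MkSymGroup (left_mulK nMn (nV nMn)) (left_mulVK nMn (nV nMn)).

Lemma left_sym_aut n (nMn : normaliser M n) : map_aut coset_map (left_sym nMn).
Proof.
move=> _ [k _ <-]; apply: symP => a; have [g ->] := flag_ofP a.
by rewrite /= !(left_mulE, right_mulE) mulgA.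
Qed.

(** Left translations move the edge of M g to the edge of M n g.  As every
edge has a flag M n with n in the normaliser, by the assumed
factorisation, they reach all of them. *)
Lemma coset_map_edge_transitive :
  (forall g, exists n e, [/\ normaliser M n, E e & g = n * e]) ->
  edge_transitive coset_map.
Proof.
move=> fact.
have EE : is_subgroup E.
  split=> [A [[]//]|g h Eg Eh A hA|g Eg A hA].
    have [[_ AM _] _] := hA; apply: AM; [exact: Eg|exact: Eh].
  by have [[_ _ AV] _] := hA; apply: AV; exact: Eg.
have [E1 EM EV] := EE.
pose edge (a : coset_flag) : set coset_flag := [set right_sym g a | g in E].
have aut a : exists n, normaliser M n /\ edge a = edge (flag_of n).
  have [g ->] := flag_ofP a; have [n [e [nMn Ee ->]]] := fact g.
  exists n; split=> //; apply/seteqP; split=> _ [k Ek <-].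
    by exists (e * k); [exact: EM|rewrite /= !right_mulE mulgA].
  exists (e^-1 * k); [by apply: EM => //; exact: EV|].
  by rewrite /= !right_mulE mulgA mulgK.
move=> _ _ [a _ <-] [b _ <-].
rewrite -[[set _ | _ in E]]/(edge a) -[[set rep coset_map g b | g in E]]/(edge b).
have [n [nn ->]] := aut a; have [m [nm ->]] := aut b.
have nq : normaliser M (n * m^-1).
  by case: (normaliser_subgroup M) => _ NM NV; apply: NM => //; exact: NV.
exists (left_sym nq); first exact: left_sym_aut.
apply/seteqP; split=> [_ [_ [k Ek <-] <-]|_ [k Ek <-]].
  exists k => //; rewrite /= !right_mulE left_mulE; congr flag_of.
  by rewrite invgM invgK !mulgA mulgVK.
exists (right_sym k (flag_of n)); first by exists k.
rewrite /= !right_mulE left_mulE; congr flag_of.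
by rewrite invgM invgK !mulgA mulgVK.
Qed.

(** It is enough to lift C to the normaliser by a function that is multiplicative
modulo M, since M acts trivially by left translations. *)
Lemma embeds_in_coset_map_aut (C : groupType) (w : C -> Gamma) :
  (forall c, normaliser M (w c)) ->
  (forall c d, M ((w (c * d))^-1 * (w c * w d))) ->
  (forall c, M (w c) -> c = 1) ->
  isomorphic_to_subgroup C (map_aut coset_map).
Proof.
move=> nw wM w1.
pose f c := left_sym (nw c).
have fM : {morph f : c d / c * d}.
  move=> c d; apply: symP => a; have [g ->] := flag_ofP a.
  rewrite /= !left_mulE; apply/flag_of_eq.
  rewrite !invgM !invgK !mulgA mulgK.
  by have := wM c d; rewrite mulgA.
pose F : {multiplicative C -> SymGroup coset_flag} :=
  HB.pack f (isMultiplicative.Build _ _ f fM).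
have FE c : F c = f c by [].
exists (range F); split.
- split=> [|_ _ [c _ <-] [d _ <-]|_ [c _ <-]].
  + by exists 1 => //; exact: multiplicative1.
  + by exists (c * d) => //; rewrite gmulfM.
  + by exists c^-1 => //; rewrite morph_inv.
- by move=> _ [c _ <-]; exact: left_sym_aut.
exists F; split=> [||_ [c _ <-]]; [by move=> c _; exists c|move=> c d _ _ e|by exists c].
apply: divg1_eq; apply: w1.
have : F (c * d^-1) (flag_of 1) = flag_of 1.
  by rewrite gmulfM morph_inv -e mulgV.
rewrite /= left_mulE => /flag_of_eq; rewrite !mulg1 invg1 mulg1.
by move=> /MV; rewrite invgK.
Qed.

End CosetMap.

(** * Presentations of Gamma by a basis of E *)

(** The pairs of involutions in the roles of x and y.  One choice of y for each
involution of E suffices, as only y distinguishes the classes in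
each family such as 2, 2*, 2P. *)
Variant edge_basis : Gamma -> Gamma -> Prop :=
| Basis02 : edge_basis (R i0) (R i2)
| Basis20 : edge_basis (R i2) (R i0)
| Basis0P : edge_basis (R i0) (R i0 * R i2).

Lemma ord3_ind (P : 'I_3 -> Prop) : P i0 -> P i1 -> P i2 -> forall i, P i.
Proof.
move=> P0 P1 P2 [[|[|[|//]]] lti].
- by rewrite (_ : Ordinal lti = i0)//; exact: val_inj.
- by rewrite (_ : Ordinal lti = i1)//; exact: val_inj.
- by rewrite (_ : Ordinal lti = i2)//; exact: val_inj.
Qed.

Lemma invol_inv (G : groupType) (a : G) : a * a = 1 -> a^-1 = a.
Proof. by move=> aa; apply: (mulgI a); rewrite mulgV aa. Qed.

Lemma invol_comm (G : groupType) (a b : G) :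
  a * a = 1 -> b * b = 1 -> (a * b) * (a * b) = 1 -> a * b = b * a.
Proof. by move=> aa bb /invol_inv <-; rewrite invgM !invol_inv. Qed.

(** Gamma is the free product of a Klein four-group, with any basis
(x, y), and the group of order 2 generated by R1. *)
Lemma basis_universal x y (xy : edge_basis x y) (G : groupType) (a b c : G) :
  a * a = 1 -> b * b = 1 -> c * c = 1 -> (a * b) * (a * b) = 1 ->
  exists phi : {multiplicative Gamma -> G},
    [/\ phi x = a, phi y = b & phi (R i1) = c].
Proof.
move=> aa bb cc abab; have ab := invol_comm aa bb abab.
pose r p q : 'I_3 -> G := fun i => if i == i0 then p else if i == i2 then q else c.
have univ p q : p * p = 1 -> q * q = 1 -> (p * q) * (p * q) = 1 ->
    exists phi : {multiplicative Gamma -> G},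
      [/\ phi (R i0) = p, phi (R i2) = q & phi (R i1) = c].
  move=> pp qq pqpq.
  have rr i : r p q i * r p q i = 1 by elim/ord3_ind: i.
  by have [phi [phiR _]] := Gamma_universal rr pqpq; exists phi; rewrite !phiR.
case: xy.
- exact: univ.
- have [|phi [? ? ?]] := univ b a bb aa; first by rewrite -ab.
  by exists phi.
- have [||phi [pa pb pc]] := univ a (a * b) aa;
    [by []|by rewrite !mulgA aa mul1g -(mulgA b) aa mulg1|].
  by exists phi; rewrite gmulfM pa pb mulgA aa mul1g.
Qed.

Lemma Gamma_ind (Q : Gamma -> Prop) :
  Q 1 -> (forall i g, Q g -> Q (R i * g)) -> forall g, Q g.
Proof.
move=> Q1 QM g; rewrite -(word_ofK g); elim: (word_of g) => [//|i w IH].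
by rewrite -cat1s word_cat; exact: QM.
Qed.

Lemma equivariant (A B : Type) (phi : {multiplicative Gamma -> SymGroup A})
    (psi : {multiplicative Gamma -> SymGroup B}) (f : A -> B) x y :
  edge_basis x y ->
  (forall a, f (phi x a) = psi x (f a)) ->
  (forall a, f (phi y a) = psi y (f a)) ->
  (forall a, f (phi (R i1) a) = psi (R i1) (f a)) ->
  forall g a, f (phi g a) = psi g (f a).
Proof.
move=> xy fx fy fz.
have fR i a : f (phi (R i) a) = psi (R i) (f a).
  elim/ord3_ind: i => //; case: xy fx fy => // f0 f02.
  have -> : R i2 = R i0 * (R i0 * R i2) by rewrite mulgA R_sq mul1g.
  by rewrite [phi _]gmulfM [psi _]gmulfM /= f02 f0.
elim/Gamma_ind => [a|i g IH a]; first by rewrite !multiplicative1.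
by rewrite !gmulfM /= IH fR.
Qed.

Definition sym_of_involution (T : Type) (f : T -> T) (fK : involutive f) : SymGroup T :=
  MkSymGroup fK fK.

Lemma sym_of_involution_sq T f fK : @sym_of_involution T f fK * sym_of_involution fK = 1.
Proof. by apply: symP => p /=; rewrite fK. Qed.

(** * Lamplighter actions *)

(** Conjugation by the walk y R1, oriented so that on the street below the
translate by n looks n sites ahead. *)
Definition translate (y : Gamma) (n : nat) (g : Gamma) : Gamma :=
  g ^ ((y * R i1) ^- n).

(** These commutators, for n not divisible by m, are the relators that connect
the infinite action with the finite ones. *)
Definition lamp_commutator (x y : Gamma) (n : nat) : Gamma := [~ x, translate y n x].

Section Lamplighter.
Context (Y : Type) (H : int -> SymGroup Y) (HH : forall k, H k * H k = 1).

(** Sites are indexed by the integers; the boolean is the side of the street,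
which fixes the direction of the walk. *)
Definition street : Type := (Y * int * bool)%type.

Definition diag (f : int -> bool -> SymGroup Y) : SymGroup street.
Proof.
refine (@MkSymGroup street (fun p => (f p.1.2 p.2 p.1.1, p.1.2, p.2))
  (fun p => ((f p.1.2 p.2)^-1 p.1.1, p.1.2, p.2)) _ _).
- by move=> [[u k] b] /=; rewrite sym_funK.
- by move=> [[u k] b] /=; rewrite sym_invK.
Defined.

Lemma diagM f g : diag f * diag g = diag (fun k b => f k b * g k b).
Proof. by apply: symP => -[[u k] b]. Qed.

Lemma diagV f : (diag f)^-1 = diag (fun k b => (f k b)^-1).
Proof. by apply: symP => -[[u k] b]. Qed.

Lemma diagR f g : [~ diag f, diag g] = diag (fun k b => [~ f k b, g k b]).
Proof. by rewrite /commg /conjg !diagV !diagM. Qed.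

Lemma eq_diag f g : (forall k b, f k b = g k b) -> diag f = diag g.
Proof. by move=> fg; apply: symP => -[[u k] b] /=; rewrite fg. Qed.

Lemma diag1 : diag (fun _ _ => 1) = 1.
Proof. by apply: symP => -[[u k] b]. Qed.

Definition cross (p : street) : street := (p.1, ~~ p.2).
Definition walk (p : street) : street :=
  (p.1.1, if p.2 then p.1.2 + 1 else p.1.2 - 1, ~~ p.2)%R.

Lemma crossK : involutive cross.
Proof. by move=> [p b]; rewrite /cross /= negbK. Qed.
Lemma walkK : involutive walk.
Proof. by move=> [[u k] []]; rewrite /walk /= ?GRing.addrK ?GRing.subrK. Qed.

Notation lampsym := (diag (fun k _ => H k)).
Notation crosssym := (sym_of_involution crossK).
Notation walksym := (sym_of_involution walkK).

Definition ahead (n : nat) (k : int) (b : bool) : int :=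
  (if b then k - n%:Z else k + n%:Z)%R.

Lemma translationE n p :
  ((crosssym * walksym) ^+ n) p = (p.1.1, ahead n p.1.2 p.2, p.2).
Proof.
elim: n p => [|n IH] [[u k] b].
  by rewrite expg0 /= /ahead; case: b; congr (_, _, _); lia.
rewrite expgSr /= IH /= /ahead /walk /=.
by case: b => /=; congr (_, _, _); lia.
Qed.

(** Conjugating by the walk shifts a diagonal action, in opposite directions on
the two sides of the street. *)
Lemma translation_diag n f :
  diag f ^ ((crosssym * walksym) ^- n) = diag (fun k b => f (ahead n k b) b).
Proof.
rewrite /conjg invgK.
set t := (crosssym * walksym) ^+ n.
suff e : t * diag f = diag (fun k b => f (ahead n k b) b) * t.
  by rewrite mulgA e mulgK.
by apply: symP => -[[u k] b]; rewrite /= !translationE.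
Qed.

(** The involution x is diagonal and equal on both sides of the street, hence
commutes with the crossing y. *)
Lemma lamplighter x y : edge_basis x y ->
  exists psi : {multiplicative Gamma -> SymGroup street},
  forall n, psi (translate y n x) = diag (fun k b => H (ahead n k b)).
Proof.
move=> xy.
have [||||psi [px py pz]] := basis_universal xy (a := lampsym) (b := crosssym) (c := walksym).
- by rewrite diagM -diag1; apply: eq_diag => k _; exact: HH.
- exact: sym_of_involution_sq.
- exact: sym_of_involution_sq.
- apply: symP => -[[u k] b]; rewrite /= /cross /= negbK.
  by have /(congr1 (fun s : SymGroup Y => s u)) /= -> := HH k.
exists psi => n.
by rewrite /translate morph_conj morph_inv morph_exp gmulfM px py pz translation_diag.
Qed.

End Lamplighter.

Lemma sym_mulE (T : Type) (s t : SymGroup T) p : (s * t) p = t (s p).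
Proof. by []. Qed.

(** * A homomorphism made of commutators of involutions *)

Section Wreath.
Context (C : groupType).

Definition room : Type := (C * int * bool)%type.

(** Constructor kept folded so that long products of permutations can be
evaluated one factor at a time. *)
Definition spot (u : C) (n : int) (l : bool) : room := (u, n, l).

Definition half_shift (c : C) (n : int) : C := if (0 <= n)%R then c else 1.

Definition exchange_fun c (p : room) : room :=
  (p.1.1 * (if p.2 then (half_shift c p.1.2)^-1 else half_shift c p.1.2),
   p.1.2, ~~ p.2).

Definition reflect_fun (e : int) (p : room) : room :=
  (p.1.1, if p.2 then p.1.2 else e - p.1.2, p.2)%R.

Lemma exchangeK c : involutive (exchange_fun c).
Proof. by move=> [[u n] []]; rewrite /exchange_fun /= ?mulgK ?mulgVK. Qed.

Lemma reflectK e : involutive (reflect_fun e).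
Proof. by move=> [[u n] []]; rewrite /reflect_fun /= ?GRing.subKr. Qed.

(** Exchanging the two layers while multiplying by c on the nonnegative half line.
The product of exchange c with exchange 1 acts by c on the half line of one
layer and by its inverse on the other layer. *)
Definition exchange c : SymGroup room := sym_of_involution (exchangeK c).
Definition reflection e : SymGroup room := sym_of_involution (reflectK e).

(** The commutator of the two reflections is a translation by 2 of one layer, and
fixes the other.  Its commutator with the diagonal action of c on a half line
is the action of c on the two points which the translation pushes over the
boundary.  This form makes c |-> twist c a homomorphism although c enters
through involutions only. *)
Definition twist c : SymGroup room :=
  [~ exchange c * exchange 1, [~ reflection 1, reflection 0]].

Lemma exchangeE c u n l : exchange c (spot u n l) =
  spot (u * (if l then (half_shift c n)^-1 else half_shift c n)) n (~~ l).
Proof. by []. Qed.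

Lemma reflectionE e u n l :
  reflection e (spot u n l) = spot u (if l then n else e - n)%R l.
Proof. by []. Qed.

Lemma exchangeV c : (exchange c)^-1 = exchange c.
Proof. exact: symP. Qed.

Lemma reflectionV e : (reflection e)^-1 = reflection e.
Proof. exact: symP. Qed.

Lemma step_back u n l : [~ reflection 1, reflection 0] (spot u n l) =
  spot u (if l then n else n - 2)%R l.
Proof.
rewrite /commg /conjg !reflectionV !sym_mulE.
by rewrite !reflectionE; case: l; congr spot; lia.
Qed.

Lemma step_backV u n l : [~ reflection 1, reflection 0]^-1 (spot u n l) =
  spot u (if l then n else n + 2)%R l.
Proof.
apply: (can_inj (sym_funK [~ reflection 1, reflection 0])).
rewrite -[LHS]/(([~ reflection 1, reflection 0]^-1 * [~ reflection 1, reflection 0]) _).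
by rewrite mulVg step_back; case: l; congr spot; lia.
Qed.

Lemma twistE c u n l : twist c (spot u n l) =
  spot (if ~~ l && (-2 <= n < 0)%R then u * c else u) n l.
Proof.
rewrite /twist; move: [~ reflection 1, reflection 0] step_back step_backV => q qE qVE.
rewrite commgEl conjgE (invgM (exchange c)) !exchangeV !sym_mulE.
rewrite !exchangeE qVE qE /= /half_shift.
case: l => /=.
  by congr spot; case: ifP; rewrite ?invg1 ?mulg1 ?mulgK ?mulgVK.
congr spot; last lia.
by repeat case: ifP; intros; rewrite ?invg1 ?mulg1 ?mulgK ?mulgVK //; exfalso; lia.
Qed.

Lemma twistM c d : twist (c * d) = twist c * twist d.
Proof.
apply: symP => -[[u n] l]; rewrite sym_mulE -[(u, n, l)]/(spot u n l) !twistE.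
by case: ifP => //; rewrite mulgA.
Qed.

Lemma twist_eq1 c : twist c = 1 -> c = 1.
Proof.
move=> /(congr1 (fun s : SymGroup room => s (spot 1 (- 1)%R false))).
by rewrite twistE /= mul1g => -[].
Qed.

Context (d : nat -> C).

(** The two reflections are at the sites 0 and 1, and the exchanges are at odd
sites from 3 on.  Hence 0, 1 is the only pair of adjacent occupied sites. *)
Definition lamp_at (k : int) : SymGroup room :=
  match k with
  | Posz 0 => reflection 1
  | Posz 1 => reflection 0
  | Posz n.+2 => if odd n then exchange (d n./2) else 1
  | Negz _ => 1
  end.

Lemma lamp_at_sq k : lamp_at k * lamp_at k = 1.
Proof.
case: k => [[|[|n]]|n] /=; rewrite ?mulg1 ?sym_of_involution_sq//.
by case: odd; rewrite ?mulg1 ?sym_of_involution_sq.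
Qed.

Lemma lamp_at_adjacent k :
  lamp_at k = 1 \/ lamp_at (k + 1)%R = 1 \/ k = 0%R.
Proof.
case: k => [[|[|n]]|n]; first by right; right.
- by right; left.
- rewrite (_ : (Posz n.+2 + 1)%R = Posz n.+3) /=; last by lia.
  by case: odd; [right; left|left].
- by left.
Qed.

Lemma lamp_at_exchange n : lamp_at (n.*2.+3)%N = exchange (d n).
Proof. by rewrite /= odd_double /= uphalf_double. Qed.

(** The inner commutator survives only where a site and the next one in walking
direction are both occupied.  Walking forward this is the site 0 alone.
Walking backward it is the site 1, but from there the exchanges would have to
be found at negative sites, so the outer commutator vanishes. *)
Lemma twist_lamps c i j k b : d i = c -> d j = 1 ->
  [~ lamp_at (ahead (i.*2.+3)%N k b) * lamp_at (ahead (j.*2.+3)%N k b),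
     [~ lamp_at (ahead 0 k b), lamp_at (ahead 1 k b)]] =
  if ~~ b && (k == 0%R) then twist c else 1.
Proof.
move=> di dj; case: b => /=; rewrite /ahead.
  have [k0|k0] := eqVneq k 1%R.
    rewrite k0.
    rewrite (_ : (1 - _)%R = Negz i.*2.+1); last by lia.
    rewrite (_ : (1 - _)%R = Negz j.*2.+1); last by lia.
    by rewrite /= mulg1 comm1g.
  have := lamp_at_adjacent (k - 1)%R; rewrite GRing.subrK GRing.subr0.
  case=> [->|[->|]]; rewrite ?comm1g ?commg1 //.
  by lia.
have [->|k0] := eqVneq k 0%R.
  by rewrite !GRing.add0r !lamp_at_exchange di dj.
have := lamp_at_adjacent k; rewrite GRing.addr0.
case=> [->|[->|e]]; rewrite ?comm1g ?commg1 //.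
by rewrite e in k0.
Qed.

Context (m : nat) (m_gt0 : (0 < m)%N).

Definition spread (k : int) : SymGroup room :=
  if (m %| k)%Z then lamp_at (k %/ m)%Z else 1.

Lemma spread_sq k : spread k * spread k = 1.
Proof. by rewrite /spread; case: ifP => _; rewrite ?lamp_at_sq ?mulg1. Qed.

Lemma spread_ahead i k b : spread (ahead (m * i)%N k b) =
  if (m %| k)%Z then lamp_at (ahead i (k %/ m)%Z b) else 1.
Proof.
have e : ahead (m * i) k b = (k + (if b then - i%:Z else i%:Z) * m)%R.
  by rewrite /ahead; case: b; lia.
rewrite /spread e GRing.rpredDr ?dvdz_mull//.
case: ifP => // mk; rewrite divzDl // mulzK; last by lia.
by rewrite /ahead; case: (b).
Qed.

Lemma spread_aheadN n k b : ~~ (m %| n)%N ->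
  spread k = 1 \/ spread (ahead n k b) = 1.
Proof.
move=> mn; rewrite /spread; case: ifP => mk; [right|by left].
rewrite ifN// /ahead; case: b.
  by rewrite GRing.rpredBl.
by rewrite GRing.rpredDl.
Qed.

End Wreath.

(** * Embedding a countable group *)

Definition commutator_word (G : groupType) (p q r s : G) : G :=
  [~ p * q, [~ r, s]].

Lemma morph_commutator_word (G H : groupType) (f : {multiplicative G -> H}) p q r s :
  f (commutator_word p q r s) = commutator_word (f p) (f q) (f r) (f s).
Proof. by rewrite /commutator_word morph_comm gmulfM morph_comm. Qed.

Lemma diag_commutator_word (Y : Type) (p q r s : int -> bool -> SymGroup Y) :
  commutator_word (diag p) (diag q) (diag r) (diag s) =
  diag (fun k b => commutator_word (p k b) (q k b) (r k b) (s k b)).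
Proof. by rewrite /commutator_word diagM !diagR. Qed.

Lemma spread_word (C : groupType) (d : nat -> C) m c i j k b :
  (0 < m)%N -> d i = c -> d j = 1 ->
  commutator_word (spread d m (ahead (m * i.*2.+3)%N k b))
    (spread d m (ahead (m * j.*2.+3)%N k b))
    (spread d m (ahead (m * 0)%N k b)) (spread d m (ahead (m * 1)%N k b)) =
  if ~~ b && (k == 0%R) then twist c else 1.
Proof.
move=> m_gt0 di dj; rewrite !spread_ahead// /commutator_word; case: ifP => mk.
  rewrite (twist_lamps _ _ di dj) (_ : ((k %/ m)%Z == 0%R) = (k == 0%R))//.
  by rewrite -{2}(divzK mk) GRing.mulIr_eq0 //; apply: GRing.mulIf; lia.
rewrite mulg1 comm1g ifN//; apply/negP => /andP[_ /eqP k0].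
by rewrite k0 dvdz0 in mk.
Qed.

Lemma translate_periodic (G : groupType) (phi : {multiplicative Gamma -> G}) x y m i :
  phi ((y * R i1) ^+ m) = 1 -> phi (translate y (m * i) x) = phi x.
Proof.
move=> phit; rewrite /translate expgM morph_conj morph_inv morph_exp phit.
by rewrite expg1n invg1 conjg1.
Qed.

Lemma lamp_spread (C : groupType) (d : nat -> C) m x y
    (psi : {multiplicative Gamma -> SymGroup (street (room C))}) n :
  (forall n, psi (translate y n x) = diag (fun k b => spread d m (ahead n k b))) ->
  ~~ (m %| n)%N -> psi (lamp_commutator x y n) = 1.
Proof.
move=> psiE mn; have e0 : psi x = diag (fun k b => spread d m (ahead 0 k b)).
  by rewrite -psiE /translate invg1 conjg1.
rewrite /lamp_commutator morph_comm e0 psiE diagR -diag1; apply: eq_diag => k b.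
have -> : ahead 0 k b = k by rewrite /ahead; case: b; lia.
by case: (spread_aheadN d k b mn) => ->; rewrite ?comm1g ?commg1.
Qed.

Lemma twist_diagM (C : groupType) (c c' : C) :
  diag (fun k b => if ~~ b && (k == 0%R) then twist (c * c') else 1) =
  diag (fun k b => if ~~ b && (k == 0%R) then twist c else 1) *
  diag (fun k b => if ~~ b && (k == 0%R) then twist c' else 1).
Proof.
rewrite diagM; apply: eq_diag => k b.
by case: ifP => _; [exact: twistM|rewrite mulg1].
Qed.

Lemma twist_diag_eq1 (C : groupType) (c : C) :
  diag (fun k b => if ~~ b && (k == 0%R) then twist c else 1) = 1 -> c = 1.
Proof.
move=> psi1; apply: twist_eq1; apply: symP => p.
exact: (congr1 (fun s : SymGroup (street (room C)) => (s (p, 0%R, false)).1.1) psi1).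
Qed.

(** The last property holds because the words w c involve only translates by
multiples of m: if (y z)^m becomes trivial they all become x, and
a commutator of powers of x is 1. *)
Lemma lamplighter_embedding (C : groupType) (hC : countable [set: C]) x y (m : nat) :
  edge_basis x y -> (0 < m)%N ->
  exists (Omega : Type) (psi : {multiplicative Gamma -> SymGroup Omega})
    (w : C -> Gamma),
  [/\ forall n, ~~ (m %| n)%N -> psi (lamp_commutator x y n) = 1,
      forall c d, psi (w (c * d)) = psi (w c) * psi (w d),
      forall c, psi (w c) = 1 -> c = 1
    & forall (G : groupType) (phi : {multiplicative Gamma -> G}),
        phi ((y * R i1) ^+ m) = 1 -> forall c, phi (w c) = 1].
Proof.
move=> xy m_gt0; have /countable_injP[e e_inj] := hC.
have /choice[d dE] n : exists v, forall c, e c = n -> v = c.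
  have [[c0 <-]|nc] := pselect (exists c, e c = n).
    by exists c0 => c /e_inj ->//; rewrite inE.
  by exists 1 => c ec; case: nc; exists c.
have {}dE c : d (e c) = c by exact: dE.
have [psi psiE] := lamplighter (spread_sq d m) xy.
pose T i := translate y (m * i) x.
(* The exchanges of c and of 1, against the two reflections. *)
pose w c := commutator_word (T (e c).*2.+3) (T (e 1).*2.+3) (T 0%N) (T 1%N).
have psiw c : psi (w c) =
    diag (fun k b => if ~~ b && (k == 0%R) then twist c else 1).
  rewrite morph_commutator_word !psiE diag_commutator_word.
  by apply: eq_diag => k b; exact: spread_word.
exists (street (room C)), psi, w; split.
- by move=> n; exact: lamp_spread.
- by move=> c c'; rewrite !psiw twist_diagM.
- by move=> c; rewrite psiw; exact: twist_diag_eq1.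
- move=> G phi phit c; rewrite morph_commutator_word !translate_periodic//.
  by rewrite /commutator_word commgg commg1.
Qed.

(** * Normalisers of intersections *)

Definition realises (C : groupType) (N : set Gamma) : Prop :=
  exists M : flagmap, [/\ edge_transitive M,
    forall a : flag M, conjugate_sets N (normaliser (map_subgroup a))
    & isomorphic_to_subgroup C (map_aut M)].

(** Such an l is in the kernel of every lamplighter action with parameter m. *)
Definition lamp_consequence x y m (l : Gamma) : Prop :=
  forall (G : groupType) (psi : {multiplicative Gamma -> G}),
    (forall n, ~~ (m %| n)%N -> psi (lamp_commutator x y n) = 1) -> psi l = 1.

Section Realisation.
Context (P S : Type) (X : {multiplicative Gamma -> SymGroup (P * S)})
  (XS : {multiplicative Gamma -> SymGroup S}).
Hypothesis X_skew : forall g p, (X g p).2 = XS g p.2.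

Definition fixes_fibre (s : S) (g : Gamma) : Prop :=
  forall i, X g (i, s) = (i, s).

(** Conjugation by g transports the fibres along the action on S. *)
Lemma fixes_fibre_conj s g h :
  fixes_fibre (XS g s) (h ^ g) <-> fixes_fibre s h.
Proof.
have conjE p : X (h ^ g) (X g p) = X g (X h p).
  by rewrite -!sym_mulE -!gmulfM conjgE mulVKg.
split=> fx i.
  apply: (can_inj (sym_funK (X g))); rewrite -conjE.
  by rewrite (surjective_pairing (X g (i, s))) X_skew fx.
have [[j t] e] : exists p, X g p = (i, XS g s).
  by exists (sym_inv (X g) (i, XS g s)); rewrite sym_invK.
have st : t = s.
  by apply: (can_inj (sym_funK (XS g))); rewrite -(X_skew g (j, t)) e.
by rewrite -e conjE st fx.
Qed.

(** The map subgroup is the intersection of the kernel of the lamplighter action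
with the pointwise stabiliser of the fibre over s0.  The hypothesis on
words excludes from its normaliser everything that moves s0. *)
Lemma realisation (C : groupType) (hC : countable [set: C]) x y m s0 :
  edge_basis x y -> (0 < m)%N ->
  (forall s, exists2 e, E e & XS e s0 = s) ->
  X ((y * R i1) ^+ m) = 1 ->
  (forall s, s <> s0 -> exists l,
    [/\ lamp_consequence x y m l, fixes_fibre s l & ~ fixes_fibre s0 l]) ->
  realises C [set g | XS g s0 = s0].
Proof.
move=> xy m_gt0 Etrans Xm sep.
have [Omega [psi [w [lamp1 wM w1 wtriv]]]] := lamplighter_embedding hC xy m_gt0.
pose M : set Gamma := [set g | psi g = 1 /\ fixes_fibre s0 g].
have M_subgroup : is_subgroup M.
  split=> [|g h [pg fg] [ph fh]|g [pg fg]]; split.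
  - exact: multiplicative1.
  - by move=> i; rewrite multiplicative1.
  - by rewrite gmulfM pg ph mulg1.
  - by move=> i; rewrite gmulfM /= fg fh.
  - by rewrite morph_inv pg invg1.
  - by move=> i; rewrite morph_inv -{1}(fg i) /= sym_funK.
have M_normal g :
    (forall h, fixes_fibre s0 (h ^ g) <-> fixes_fibre s0 h) -> normaliser M g.
  move=> fg; apply/normaliserP => h; rewrite /M /= fg morph_conj.
  by split=> -[/eqP ph fh]; split=> //; apply/eqP; rewrite conjg_eq1 in ph *.
have nM : normaliser M = [set g | XS g s0 = s0].
  apply/seteqP; split=> g.
    move=> /normaliserP ng; apply: contrapT => /= /sep[l [lc fl nfl]].
    (* The conjugate of l by the inverse of g lies in M. *)
    apply: nfl; suff [] : M l by [].
    rewrite -[l](conjgKV g); apply/ng; split.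
      by rewrite morph_conj (lc _ _ lamp1) conj1g.
    by apply/(fixes_fibre_conj s0 g); rewrite conjgKV.
  move=> /= gs0; apply: M_normal => h.
  by rewrite -{1}gs0; exact: fixes_fibre_conj.
exists (coset_map M); split.
- apply: coset_map_edge_transitive => g.
  have [e Ee es] := Etrans (XS g s0).
  (* As e agrees with g on s0, the quotient lies in the stabiliser. *)
  exists (g * e^-1), e; split=> //; last by rewrite mulgVK.
  by rewrite nM /= gmulfM morph_inv /= -es sym_funK.
- move=> a; have [g ->] := flag_ofP a.
  by exists g; rewrite (coset_map_subgroup M_subgroup) normaliser_conj nM.
- have Xw c : X (w c) = 1 by exact: wtriv.
  apply: (embeds_in_coset_map_aut M_subgroup (w := w)) => [c|c d|c [pc _]].
  + by apply: M_normal => h; rewrite /fixes_fibre morph_conj Xw conjg1.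
  + split; first by rewrite gmulfM morph_inv wM gmulfM mulVg.
    by move=> i; rewrite !gmulfM morph_inv !Xw invg1 !mul1g.
  + exact: w1.
Qed.

End Realisation.

(** * Finite actions given by voltages *)

Lemma E_basis x y : edge_basis x y -> [/\ E 1, E x, E y & E (x * y)].
Proof.
have E1 : E 1 by move=> A [[A1 _ _] _].
have EM g h : E g -> E h -> E (g * h).
  by move=> Eg Eh A hA; case: (hA) => -[_ AM _] _; apply: AM; [exact: Eg|exact: Eh].
have E0 : E (R i0) by move=> A [_]; apply; left.
have E2 : E (R i2) by move=> A [_]; apply; right.
by case=> {x y}; split=> //; apply: (EM) => //; apply: (EM).
Qed.

Lemma skew_involutive (P S : Type) (v : S -> P -> P) (g : S -> S) :
  involutive g -> (forall s i, v (g s) (v s i) = i) ->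
  involutive (fun p : P * S => (v p.2 p.1, g p.2)).
Proof. by move=> gK vK [i s] /=; rewrite gK vK. Qed.

Lemma sym_of_involution_commute (T : Type) (f g : T -> T) fK gK :
  (forall p, f (g p) = g (f p)) ->
  let a := @sym_of_involution T f fK in let b := @sym_of_involution T g gK in
  (a * b) * (a * b) = 1.
Proof. by move=> fg a b; apply: symP => p /=; rewrite fg fK gK. Qed.

Section Voltages.
Context (P S : Type) (gx gy gz : S -> S) (vy : P -> P) (vz : S -> P -> P).
Hypotheses (gxK : involutive gx) (gyK : involutive gy) (gzK : involutive gz).
Hypotheses (gxy : forall s, gx (gy s) = gy (gx s)).
Hypotheses (vyK : involutive vy) (vzK : forall s i, vz (gz s) (vz s i) = i).

Definition sym_x := sym_of_involution
  (skew_involutive (v := fun _ (i : P) => i) gxK (fun _ _ => erefl)).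
Definition sym_y := sym_of_involution
  (skew_involutive (v := fun _ => vy) gyK (fun _ => vyK)).
Definition sym_z := sym_of_involution (skew_involutive gzK vzK).

(** Relabelling the fibres makes the voltage of x trivial.  A voltage of y that is
the same on all fibres then ensures that x and y commute. *)
Lemma voltage_action x y : edge_basis x y ->
  exists (X : {multiplicative Gamma -> SymGroup (P * S)})
    (XS : {multiplicative Gamma -> SymGroup S}),
  [/\ forall g p, (X g p).2 = XS g p.2,
      [/\ X x = sym_x, X y = sym_y & X (R i1) = sym_z]
    & [/\ forall s, XS x s = gx s, forall s, XS y s = gy s & forall s, XS (R i1) s = gz s]].
Proof.
move=> xy.
have [||||X [Xx Xy Xz]] := basis_universal xy (a := sym_x) (b := sym_y) (c := sym_z).
- exact: sym_of_involution_sq.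
- exact: sym_of_involution_sq.
- exact: sym_of_involution_sq.
- by apply: sym_of_involution_commute => -[i s] /=; rewrite gxy.
have [||||XS [XSx XSy XSz]] := basis_universal xy (a := sym_of_involution gxK)
  (b := sym_of_involution gyK) (c := sym_of_involution gzK).
- exact: sym_of_involution_sq.
- exact: sym_of_involution_sq.
- exact: sym_of_involution_sq.
- exact: sym_of_involution_commute.
exists X, XS; split; rewrite ?Xx ?Xy ?Xz ?XSx ?XSy ?XSz//.
apply: (equivariant (f := snd) xy) => p.
- by rewrite Xx XSx.
- by rewrite Xy XSy.
- by rewrite Xz XSz.
Qed.

End Voltages.

(** The stabiliser of s0 is expressed through an action with prescribed generators
so that one finite computation serves all choices of the basis (x, y). *)
Definition realised_stabiliser (S : Type) (gx gy gz : S -> S) (s0 : S) : Prop :=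
  forall (C : groupType), countable [set: C] -> forall x y, edge_basis x y ->
  exists XS : {multiplicative Gamma -> SymGroup S},
  [/\ forall s, XS x s = gx s, forall s, XS y s = gy s,
      forall s, XS (R i1) s = gz s & realises C [set g | XS g s0 = s0]].


Section Separation.
Context (S : eqType) (gx gy gz : S -> S) (P : eqType) (vy : P -> P) (vz : S -> P -> P).
Hypotheses (gxK : involutive gx) (gyK : involutive gy) (gzK : involutive gz).
Hypotheses (vyK : involutive vy) (vzK : forall s i, vz (gz s) (vz s i) = i).
Hypotheses (gxy : forall s, gx (gy s) = gy (gx s)).

Context (W : forall G : groupType, G -> G -> G -> G) (m : nat) (m_gt0 : (0 < m)%N) (s0 : S).
Hypothesis W_natural : forall (G H : groupType) (f : {multiplicative G -> H}) a b c,
  f (W a b c) = W (f a) (f b) (f c).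
Hypothesis W_lamps : forall (G : groupType) (a b c : G),
  (forall n, ~~ (m %| n)%N -> [~ a, a ^ ((b * c) ^- n)] = 1) -> W a b c = 1.
Hypothesis S_transitive : forall s, s \in [:: s0; gx s0; gy s0; gy (gx s0)].

Let sx := sym_x P gxK.
Let sy := sym_y gyK vyK.
Let sz := sym_z gzK vzK.

Hypothesis period : forall p, ((sy * sz) ^+ m) p == p.
Hypothesis W_fixes : forall p, (p.2 == s0) || (W sx sy sz p == p).
Hypothesis W_moves : exists i, W sx sy sz (i, s0) != (i, s0).

(** The word W is a function of three elements of an arbitrary group, natural in
the group, so that its value can be computed in the finite permutation group
and shown to follow from the lamp relators.  The number m must be a multiple of
the order of y z that divides none of the exponents in those relators. *)
Lemma voltage_realisation : realised_stabiliser gx gy gz s0.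
Proof.
move=> C hC x y xy.
have [X [XS [X_skew [Xx Xy Xz] [XSx XSy XSz]]]] :=
  voltage_action gxK gyK gzK gxy vyK vzK xy.
exists XS; split=> //.
apply: (realisation (X := X) (m := m) X_skew hC xy m_gt0).
- have [E1 Ex Ey Exy] := E_basis xy.
  move=> s; have := S_transitive s; rewrite !inE => /or4P[]/eqP ->.
  + by exists 1 => //; rewrite multiplicative1.
  + by exists x.
  + by exists y.
  + by exists (x * y) => //; rewrite gmulfM sym_mulE XSx XSy.
- apply: symP => p; rewrite morph_exp gmulfM Xy Xz; exact/eqP/period.
- move=> s /eqP/negbTE ss0; exists (W x y (R i1)); split.
  + move=> G psi lamp1; rewrite W_natural; apply: W_lamps => n mn.
    rewrite -(lamp1 n mn) /lamp_commutator /translate.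
    by rewrite !(morph_comm, morph_conj, morph_inv, morph_exp, morph_mul psi).
  + move=> i; rewrite W_natural Xx Xy Xz; apply/eqP.
    by have := W_fixes (i, s); rewrite /= ss0.
  + move=> fx; have [i /eqP] := W_moves; apply.
    by rewrite -[RHS](fx i) W_natural Xx Xy Xz.
Qed.

End Separation.
Arguments voltage_realisation {S gx gy gz P vy vz} gxK gyK gzK vyK vzK gxy
  W m m_gt0 {s0}.

(** * Separating words *)

Definition trivial_action (T : Type) : {multiplicative Gamma -> SymGroup T} :=
  HB.pack (fun _ : Gamma => 1 : SymGroup T)
    (isMultiplicative.Build Gamma (SymGroup T) (fun _ => 1)
       (fun _ _ => esym (mulg1 1))).

(** In the actions used below k is a nontrivial translation on each fibre,
and this word is trivial where z inverts k. *)
Definition dihedral_word (G : groupType) (x y z : G) : G :=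
  let k := [~ x, x ^ ((y * z) ^- 4)] in k * k ^ z.

(** In the actions used below k acts on a fibre as an affine map of multiplier 2
or 4, and t as a translation.  Conjugation by k raises t to the power 2 or 4,
so the word tells k from its inverse. *)
Definition chiral_word (G : groupType) (k q : G) : G :=
  let t := k^-1 * k ^ q in t ^- 2 * t ^ k.

Definition chiral_word1 (G : groupType) (x y z : G) : G :=
  chiral_word [~ x, x ^ ((y * z) ^- 1)] y.

(** The element x z y x returns to the fibre it starts from after a detour through
the two fibres that y and z do not reach from there. *)
Definition chiral_word4 (G : groupType) (x y z : G) : G :=
  chiral_word [~ x, x ^ ((y * z) ^- 4)] (x * z * y * x).

(** * Affine actions modulo 7 *)

Lemma Z7_ind (Q : 'Z_7 -> Prop) :
  Q 0%R -> Q 1%R -> Q 2%R -> Q 3%R -> Q 4%R -> Q 5%R -> Q 6%R -> forall i, Q i.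
Proof.
move=> Q0 Q1 Q2 Q3 Q4 Q5 Q6 [[|[|[|[|[|[|[|//]]]]]]] lti].
- by rewrite (_ : Ordinal lti = 0%R)//; exact: val_inj.
- by rewrite (_ : Ordinal lti = 1%R)//; exact: val_inj.
- by rewrite (_ : Ordinal lti = 2%R)//; exact: val_inj.
- by rewrite (_ : Ordinal lti = 3%R)//; exact: val_inj.
- by rewrite (_ : Ordinal lti = 4%R)//; exact: val_inj.
- by rewrite (_ : Ordinal lti = 5%R)//; exact: val_inj.
- by rewrite (_ : Ordinal lti = 6%R)//; exact: val_inj.
Qed.

Section Words.
Context (G H : groupType) (f : {multiplicative G -> H}).

Lemma morph_dihedral_word a b c :
  f (dihedral_word a b c) = dihedral_word (f a) (f b) (f c).
Proof.
by rewrite /dihedral_word !(morph_mul f, morph_conj, morph_comm, morph_inv, morph_exp).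
Qed.

Lemma morph_chiral_word a b : f (chiral_word a b) = chiral_word (f a) (f b).
Proof. by rewrite /chiral_word !(morph_mul f, morph_conj, morph_inv, morph_exp). Qed.

Lemma morph_chiral_word1 a b c :
  f (chiral_word1 a b c) = chiral_word1 (f a) (f b) (f c).
Proof.
by rewrite /chiral_word1 morph_chiral_word morph_comm morph_conj morph_inv morph_exp gmulfM.
Qed.

Lemma morph_chiral_word4 a b c :
  f (chiral_word4 a b c) = chiral_word4 (f a) (f b) (f c).
Proof.
by rewrite /chiral_word4 morph_chiral_word morph_comm morph_conj morph_inv morph_exp !gmulfM.
Qed.

Lemma dihedral_word_eq1 m (a b c : G) : ~~ (m %| 4)%N ->
  (forall n, ~~ (m %| n)%N -> [~ a, a ^ ((b * c) ^- n)] = 1) ->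
  dihedral_word a b c = 1.
Proof. by move=> m4 k1; rewrite /dihedral_word k1// conj1g mulg1. Qed.

Lemma chiral_word_eq1 (q : G) : chiral_word 1 q = 1.
Proof. by rewrite /chiral_word conj1g invg1 !mulg1 conj1g expg1n invg1 mulg1. Qed.

Lemma chiral_word1_eq1 m (a b c : G) : ~~ (m %| 1)%N ->
  (forall n, ~~ (m %| n)%N -> [~ a, a ^ ((b * c) ^- n)] = 1) ->
  chiral_word1 a b c = 1.
Proof. by move=> m1 k1; rewrite /chiral_word1 k1// chiral_word_eq1. Qed.

Lemma chiral_word4_eq1 m (a b c : G) : ~~ (m %| 4)%N ->
  (forall n, ~~ (m %| n)%N -> [~ a, a ^ ((b * c) ^- n)] = 1) ->
  chiral_word4 a b c = 1.
Proof. by move=> m4 k1; rewrite /chiral_word4 k1// chiral_word_eq1. Qed.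

End Words.

Definition opp7 (i : 'Z_7) : 'Z_7 := (- i)%R.
Definition refl7 (i : 'Z_7) : 'Z_7 := (1 - i)%R.
Definition next7 (i : 'Z_7) : 'Z_7 := (i + 1)%R.
Definition prev7 (i : 'Z_7) : 'Z_7 := (i - 1)%R.
Definition double7 (i : 'Z_7) : 'Z_7 := (i *+ 2)%R.
Definition half7 (i : 'Z_7) : 'Z_7 := (i *+ 4)%R.

Definition flip1 (s : bool * bool) := (~~ s.1, s.2).
Definition flip2 (s : bool * bool) := (s.1, ~~ s.2).
Definition half_flip (s : bool * bool) := (s.1, s.1 (+) s.2).

Lemma flip1K : involutive flip1. Proof. by move=> [[] []]. Qed.
Lemma flip2K : involutive flip2. Proof. by move=> [[] []]. Qed.
Lemma half_flipK : involutive half_flip. Proof. by move=> [[] []]. Qed.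
Lemma idK {S : Type} : involutive (@id S). Proof. by []. Qed.
Lemma opp7K : involutive opp7. Proof. exact: GRing.opprK. Qed.
Lemma refl7K : involutive refl7. Proof. exact: GRing.subKr. Qed.
Lemma double7K : cancel double7 half7. Proof. by apply: Z7_ind; exact: val_inj. Qed.
Lemma half7K : cancel half7 double7. Proof. by apply: Z7_ind; exact: val_inj. Qed.

(** With the voltage opp7 for y, the involution z inverts the translations
everywhere but on the base fibre, where its voltage is trivial.  The product y z
has order 7 or 2 on a fibre, and its fourth power kills the second kind and not
the first.  The pattern of volt3 and volt4 is the same, with a trivial voltage for
y, and with (y z)^2 in place of y z where y z moves the fibre. *)
Definition volt2 (s : bool) := if s then refl7 else id.

(** Exchanging the two fibres exchanges the multiplication by 2 with its inverse.
With the voltage refl7 for y the chiral word tells them apart. *)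
Definition volt2ex (s : bool) := if s then half7 else double7.

Definition volt3 (s : bool * bool) :=
  match s with
  | (false, false) => id | (false, true) => opp7
  | (true, false) => opp7 | (true, true) => refl7
  end.

(** The two fibres exchanged by z carry opposite translations, so that here too
z inverts the action of the lamp commutator. *)
Definition volt4 (s : bool * bool) :=
  match s with
  | (false, false) => id | (false, true) => opp7
  | (true, false) => next7 | (true, true) => prev7
  end.

(** On the fibres (false, _) the word x z y x acts by a reflection, and the
multiplication by which the lamp commutator acts is by 2 on one of them and by 4
on the other.  On the fibres (true, _) it commutes with the lamp commutator, and
the chiral word vanishes. *)
Definition volt5 (s : bool * bool) :=
  match s with
  | (false, false) => double7 | (false, true) => half7
  | (true, _) => refl7
  end.

Lemma volt2K s i : volt2 (id s) (volt2 s i) = i.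
Proof. by case: s; rewrite //= refl7K. Qed.
Lemma volt2exK s i : volt2ex (~~ s) (volt2ex s i) = i.
Proof. by case: s; rewrite /= ?double7K ?half7K. Qed.
Lemma volt3K s i : volt3 (id s) (volt3 s i) = i.
Proof. by case: s => [[] []]; rewrite /= ?opp7K ?refl7K. Qed.
Lemma volt4K s i : volt4 (half_flip s) (volt4 s i) = i.
Proof. by case: s => [[] []]; rewrite /= ?opp7K /prev7 /next7 ?GRing.addrK ?GRing.subrK. Qed.
Lemma volt5K s i : volt5 (flip2 s) (volt5 s i) = i.
Proof. by case: s => [[] []]; rewrite /= ?refl7K ?double7K ?half7K. Qed.

(** * Realising the stabilisers *)

Lemma realised_whole (C : groupType) :
  countable [set: C] -> realises C [set: Gamma].
Proof.
move=> hC; pose X := trivial_action (unit * unit).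
have -> : [set: Gamma] = [set g | trivial_action unit g tt = tt] by apply/seteqP.
apply: (realisation (X := X) (m := 1) _ hC Basis02) => //.
- by move=> []; exists 1 => //; case: (E_basis Basis02).
- by move=> [].
Qed.

Lemma realised2 : realised_stabiliser negb id id false.
Proof.
apply: (voltage_realisation negbK idK idK opp7K volt2K _ (@dihedral_word) 28) => //.
- exact: morph_dihedral_word.
- by move=> G a b c; exact: dihedral_word_eq1.
- by case.
- by case=> i s; elim/Z7_ind: i; case: s; vm_compute.
- by case=> i s; elim/Z7_ind: i; case: s; vm_compute.
- by exists 0%R; vm_compute.
Qed.

Lemma realised2ex : realised_stabiliser negb id negb false.
Proof.
apply: (voltage_realisation negbK idK negbK refl7K volt2exK _ (@chiral_word1) 14) => //.
- exact: morph_chiral_word1.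
- by move=> G a b c; exact: chiral_word1_eq1.
- by case.
- by case=> i s; elim/Z7_ind: i; case: s; vm_compute.
- by case=> i s; elim/Z7_ind: i; case: s; vm_compute.
- by exists 0%R; vm_compute.
Qed.

Lemma realised3 : realised_stabiliser flip1 flip2 id (false, false).
Proof.
apply: (voltage_realisation flip1K flip2K idK idK volt3K _ (@dihedral_word) 28) => //.
- exact: morph_dihedral_word.
- by move=> G a b c; exact: dihedral_word_eq1.
- by case=> [[] []].
- by case=> i [s t]; elim/Z7_ind: i; case: s; case: t; vm_compute.
- by case=> i [s t]; elim/Z7_ind: i; case: s; case: t; vm_compute.
- by exists 0%R; vm_compute.
Qed.

Lemma realised4 : realised_stabiliser flip1 flip2 half_flip (false, false).
Proof.
apply: (voltage_realisation flip1K flip2K half_flipK idK volt4K _ (@dihedral_word) 28) => //.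
- exact: morph_dihedral_word.
- by move=> G a b c; exact: dihedral_word_eq1.
- by case=> [[] []].
- by case=> i [s t]; elim/Z7_ind: i; case: s; case: t; vm_compute.
- by case=> i [s t]; elim/Z7_ind: i; case: s; case: t; vm_compute.
- by exists 0%R; vm_compute.
Qed.

Lemma realised5 : realised_stabiliser flip1 flip2 flip2 (false, false).
Proof.
apply: (voltage_realisation flip1K flip2K flip2K idK volt5K _ (@chiral_word4) 6) => //.
- exact: morph_chiral_word4.
- by move=> G a b c; exact: chiral_word4_eq1.
- by case=> [[] []].
- by case=> i [s t]; elim/Z7_ind: i; case: s; case: t; vm_compute.
- by case=> i [s t]; elim/Z7_ind: i; case: s; case: t; vm_compute.
- by exists 0%R; vm_compute.
Qed.

(** * Identification of the subgroups N(T) *)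

Lemma stabiliser_subgroup (S : Type) (XS : {multiplicative Gamma -> SymGroup S}) s0 :
  is_subgroup [set g | XS g s0 = s0].
Proof.
split=> [|g h /= gs hs|g /= gs] /=.
- by rewrite multiplicative1.
- by rewrite gmulfM /= gs.
- by rewrite morph_inv -{1}gs /= sym_funK.
Qed.

(** A generator that moves the two points represents the second coset. *)
Lemma index2_stabiliser (XS : {multiplicative Gamma -> SymGroup bool}) s j :
  j \notin s -> (forall i, XS (R i) false = (i \notin s)) ->
  index2_containing s [set g | XS g false = false].
Proof.
move=> js XSs; split; first exact: stabiliser_subgroup.
  exists (fun i : 'I_2 => if val i == 0%N then 1 else R j) => g.
  have jV : XS (R j)^-1 false = true.
    by rewrite (invol_inv (R_sq j)) XSs js.
  have XSg : XS g true = ~~ XS g false.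
    have : XS g true <> XS g false by move=> /(can_inj (sym_funK (XS g))).
    by case: (XS g true) (XS g false) => -[].
  have odd2 (i : 'I_2) : XS ((if val i == 0%N then 1 else R j)^-1 * g) false
      = (XS g false) (+) (val i != 0%N).
    case: (val i =P 0%N) => _ /=; first by rewrite invg1 mul1g addbF.
    by rewrite gmulfM sym_mulE jV XSg addbT.
  exists (if XS g false then ord_max else ord0); split=> [|i]; rewrite /= odd2.
    by case: (XS g false).
  by case: (XS g false); case: i => [[|[|//]] lti] //= _; exact: val_inj.
by move=> i; rewrite /= XSs; split=> [/negbFE|->].
Qed.

Lemma ord4_ind (Q : 'I_4 -> Prop) : Q p1 -> Q p2 -> Q p3 -> Q p4 -> forall i, Q i.
Proof.
move=> Q1 Q2 Q3 Q4 [[|[|[|[|//]]]] lti].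
- by rewrite (_ : Ordinal lti = p1)//; exact: val_inj.
- by rewrite (_ : Ordinal lti = p2)//; exact: val_inj.
- by rewrite (_ : Ordinal lti = p3)//; exact: val_inj.
- by rewrite (_ : Ordinal lti = p4)//; exact: val_inj.
Qed.

Ltac perm4 := rewrite ?permM /tperm ?permE; apply/eqP; vm_compute; reflexivity.

(** An injective labelling of S by {1, 2, 3, 4} that carries the action on S to
the one defining N(T) identifies the point stabilisers. *)
Lemma point_stabiliser_of_action (S : Type) (XS : {multiplicative Gamma -> SymGroup S})
    (s0 : S) (beta : S -> 'I_4) (r1 : 'S_4) :
  injective beta -> r1 * r1 = 1 ->
  (forall s, beta (XS (R i0) s) = (tperm p1 p2 * tperm p3 p4) (beta s)) ->
  (forall s, beta (XS (R i1) s) = r1 (beta s)) ->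
  (forall s, beta (XS (R i2) s) = (tperm p1 p4 * tperm p2 p3) (beta s)) ->
  point_stabiliser r1 [set g | XS g s0 = s0].
Proof.
move=> beta_inj rr e0 e1 e2.
pose r (i : 'I_3) : 'S_4 := if i == i0 then tperm p1 p2 * tperm p3 p4
  else if i == i1 then r1 else tperm p1 p4 * tperm p2 p3.
have r_sq i : r i * r i = 1.
  elim/ord3_ind: i => //; apply/permP => i; elim/ord4_ind: i; perm4.
have r_comm : (r i0 * r i2) * (r i0 * r i2) = 1.
  by apply/permP => i; elim/ord4_ind: i; perm4.
have [phi [phiR _]] := Gamma_universal r_sq r_comm.
have equi g : forall s, beta (XS g s) = phi g (beta s).
  elim/Gamma_ind: g => [s|i g IH s]; first by rewrite !multiplicative1 perm1.
  rewrite !gmulfM permM sym_mulE IH phiR; congr (phi g _).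
  by elim/ord3_ind: i.
exists phi; split; rewrite ?phiR//.
exists (beta s0); apply/seteqP; split=> g /=; rewrite -equi; first by move=> ->.
exact: beta_inj.
Qed.

Arguments point_stabiliser_of_action {S XS s0} beta {r1}.

(** The labels of s0, x s0, y s0 and x y s0. *)
Definition corners (q00 q10 q01 q11 : 'I_4) (s : bool * bool) : 'I_4 :=
  if s.2 then if s.1 then q11 else q01 else if s.1 then q10 else q00.

(** The class decides the involution y of E.  In classes 4, 4* and 4P the label of
the base point must be one of the two points that R1 fixes. *)
Lemma is_N_realised (T : et_class) (C : groupType) (hC : countable [set: C]) :
  exists2 N, is_N T N & realises C N.
Proof.
have b02 := Basis02; have b20 := Basis20; have b0P := Basis0P.
have R2E (S : Type) (XS : {multiplicative Gamma -> SymGroup S}) s :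
    XS (R i2) s = XS (R i0 * R i2) (XS (R i0) s).
  by rewrite -sym_mulE -gmulfM mulgA R_sq mul1g.
case: T.
- by exists [set: Gamma] => //; exact: realised_whole.
- have [XS [Xx Xy Xz rC]] := realised2 hC b02;
  exists [set g | XS g false = false] => //.
  by apply: (index2_stabiliser (j := i0)) => //; elim/ord3_ind; rewrite ?Xx ?Xy ?Xz.
- have [XS [Xx Xy Xz rC]] := realised2 hC b20;
  exists [set g | XS g false = false] => //.
  by apply: (index2_stabiliser (j := i2)) => //; elim/ord3_ind; rewrite ?Xx ?Xy ?Xz.
- have [XS [Xx Xy Xz rC]] := realised2 hC b0P;
  exists [set g | XS g false = false] => //.
  by apply: (index2_stabiliser (j := i0)) => //; elim/ord3_ind; rewrite ?R2E ?Xx ?Xy ?Xz.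
- have [XS [Xx Xy Xz rC]] := realised2ex hC b02;
  exists [set g | XS g false = false] => //.
  by apply: (index2_stabiliser (j := i0)) => //; elim/ord3_ind; rewrite ?Xx ?Xy ?Xz.
- have [XS [Xx Xy Xz rC]] := realised2ex hC b20;
  exists [set g | XS g false = false] => //.
  by apply: (index2_stabiliser (j := i2)) => //; elim/ord3_ind; rewrite ?Xx ?Xy ?Xz.
- have [XS [Xx Xy Xz rC]] := realised2ex hC b0P;
  exists [set g | XS g false = false] => //.
  by apply: (index2_stabiliser (j := i0)) => //; elim/ord3_ind; rewrite ?R2E ?Xx ?Xy ?Xz.
- have [XS [Xx Xy Xz rC]] := realised3 hC b02;
  exists [set g | XS g (false, false) = (false, false)] => //.
  apply: (point_stabiliser_of_action (corners p1 p2 p4 p3)).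
  + by move=> [[] []] [[] []].
  + by apply/permP; elim/ord4_ind; perm4.
  + by move=> [[] []]; rewrite ?Xx ?Xy; perm4.
  + by move=> [[] []]; rewrite Xz; perm4.
  + by move=> [[] []]; rewrite ?Xx ?Xy; perm4.
- have [XS [Xx Xy Xz rC]] := realised4 hC b02;
  exists [set g | XS g (false, false) = (false, false)] => //.
  apply: (point_stabiliser_of_action (corners p2 p1 p3 p4)).
  + by move=> [[] []] [[] []].
  + by apply/permP; elim/ord4_ind; perm4.
  + by move=> [[] []]; rewrite ?Xx ?Xy; perm4.
  + by move=> [[] []]; rewrite Xz; perm4.
  + by move=> [[] []]; rewrite ?Xx ?Xy; perm4.
- have [XS [Xx Xy Xz rC]] := realised4 hC b20;
  exists [set g | XS g (false, false) = (false, false)] => //.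
  apply: (point_stabiliser_of_action (corners p3 p2 p4 p1)).
  + by move=> [[] []] [[] []].
  + by apply/permP; elim/ord4_ind; perm4.
  + by move=> [[] []]; rewrite ?Xx ?Xy; perm4.
  + by move=> [[] []]; rewrite Xz; perm4.
  + by move=> [[] []]; rewrite ?Xx ?Xy; perm4.
- have [XS [Xx Xy Xz rC]] := realised4 hC b0P;
  exists [set g | XS g (false, false) = (false, false)] => //.
  apply: (point_stabiliser_of_action (corners p2 p1 p4 p3)).
  + by move=> [[] []] [[] []].
  + by apply/permP; elim/ord4_ind; perm4.
  + by move=> [[] []]; rewrite ?Xx ?Xy; perm4.
  + by move=> [[] []]; rewrite Xz; perm4.
  + by move=> [[] []]; rewrite R2E ?Xx ?Xy; perm4.
- have [XS [Xx Xy Xz rC]] := realised5 hC b02;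
  exists [set g | XS g (false, false) = (false, false)] => //.
  apply: (point_stabiliser_of_action (corners p1 p2 p4 p3)).
  + by move=> [[] []] [[] []].
  + by apply/permP; elim/ord4_ind; perm4.
  + by move=> [[] []]; rewrite ?Xx ?Xy; perm4.
  + by move=> [[] []]; rewrite Xz; perm4.
  + by move=> [[] []]; rewrite ?Xx ?Xy; perm4.
- have [XS [Xx Xy Xz rC]] := realised5 hC b20;
  exists [set g | XS g (false, false) = (false, false)] => //.
  apply: (point_stabiliser_of_action (corners p1 p4 p2 p3)).
  + by move=> [[] []] [[] []].
  + by apply/permP; elim/ord4_ind; perm4.
  + by move=> [[] []]; rewrite ?Xx ?Xy; perm4.
  + by move=> [[] []]; rewrite Xz; perm4.
  + by move=> [[] []]; rewrite ?Xx ?Xy; perm4.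
- have [XS [Xx Xy Xz rC]] := realised5 hC b0P;
  exists [set g | XS g (false, false) = (false, false)] => //.
  apply: (point_stabiliser_of_action (corners p1 p2 p3 p4)).
  + by move=> [[] []] [[] []].
  + by apply/permP; elim/ord4_ind; perm4.
  + by move=> [[] []]; rewrite ?Xx ?Xy; perm4.
  + by move=> [[] []]; rewrite Xz; perm4.
  + by move=> [[] []]; rewrite R2E ?Xx ?Xy; perm4.
Qed.

Theorem theorem1p7 (T : et_class) (C : groupType) (hC : countable [set: C]) :
  exists M : flagmap, in_class M T /\ isomorphic_to_subgroup C (map_aut M).
Proof.
have [N NT [M [M_et M_N M_aut]]] := is_N_realised T hC.
by exists M; split=> //; split=> // a; exists N.
Qed.
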